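(* Let $\eta\in(0,1]$, $\Psi>0$, $\gamma_{\rm SR}>0$, and let $h_{\rm RD}$ be a nonzero complex number with $\gamma_{\rm RD}=|h_{\rm RD}|^2$. For $\rho\in[0,1]$ define $$\gamma_{\rm D}(\rho)=\frac{\eta\rho(1-\rho)\Psi\,\gamma_{\rm SR}\,\gamma_{\rm RD}}{\eta\rho\,\gamma_{\rm RD}+(1-\rho)},\qquad C_{\rm AF}(\rho)=\tfrac12\log_2\bigl(1+\gamma_{\rm D}(\rho)\bigr).$$ Then the value of $\rho$ that maximizes the achievable rate $C_{\rm AF}(\rho)$ is $$\rho^{*}=\frac{1}{1+|h_{\rm RD}|\sqrt{\eta}}.$$
   Context: Interpretation: $\gamma_{\rm SR}$ and $\gamma_{\rm RD}$ are the (fixed) source-to-relay and relay-to-destination channel gains, $\eta$ is the energy conversion efficiency, $\rho$ the power splitting ratio at the relay, $\Psi$ the source transmit-power-to-noise ratio, $\gamma_{\rm D}$ the SNR at the destination, and $C_{\rm AF}$ the achievable rate. *)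

(* Defs.v *)
(* Stdlib real numbers; Coquelicot for the complex channel coefficient. *)
From Stdlib Require Import Reals.
From Coquelicot Require Import Coquelicot.
Open Scope R_scope.

(* When 0 < eta and 0 < gammaRD the denominator is positive on all of [0, 1],
   endpoints included, so the totalized division never acts on zero. *)
Definition gammaD (eta Psi gammaSR gammaRD rho : R) : R :=
  (eta * rho * (1 - rho) * Psi * gammaSR * gammaRD)
  / (eta * rho * gammaRD + (1 - rho)).

Definition C_AF (eta Psi gammaSR gammaRD rho : R) : R :=
  1 / 2 * Rlog 2 (1 + gammaD eta Psi gammaSR gammaRD rho).

Definition is_maximizer (D : R -> Prop) (f : R -> R) (x : R) : Prop :=
  D x /\ forall y : R, D y -> f y <= f x.

(* Main.v *)
(** With [t = |h_RD| sqrt eta], completing the square in the SNR gives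
    [gammaD r = M (1 - ((1 + t) r - 1)^2 / (t^2 r + 1 - r))] where
    [M = Psi gammaSR t^2 / (1 + t)^2], so [M] is attained exactly at
    [r = 1 / (1 + t)]. The rate is a strictly increasing function of the SNR. *)
Require Import Defs.
From Stdlib Require Import Reals Lra Psatz.
From Coquelicot Require Import Coquelicot.
Open Scope R_scope.

(** A convex combination of the positive numbers [a] and [1]. *)
Lemma gammaD_denominator_pos (a r : R) : 0 < a -> 0 <= r <= 1 -> 0 < a * r + (1 - r).
Proof.
  intros Ha [Hr0 Hr1].
  destruct (Req_dec r 0) as [->|Hr]; [lra|].
  assert (0 < a * r) by (apply Rmult_lt_0_compat; lra).
  lra.
Qed.

Lemma gammaD_nonneg (eta Psi gammaSR gammaRD r : R) :
  0 < eta -> 0 < Psi -> 0 < gammaSR -> 0 < gammaRD -> 0 <= r <= 1 ->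
  0 <= gammaD eta Psi gammaSR gammaRD r.
Proof.
  intros He HP HS HD Hr.
  assert (Hden := gammaD_denominator_pos (eta * gammaRD) r
                    (Rmult_lt_0_compat _ _ He HD) Hr).
  unfold gammaD; apply Rdiv_le_0_compat; [|lra].
  repeat apply Rmult_le_pos; lra.
Qed.

(** Cleared of denominators, this rests on the identity [t^2 r + (1 - r) - ((1 + t) r - 1)^2 = (1 +
    t)^2 r (1 - r)]. *)
Lemma gammaD_complete_square (eta Psi gammaSR gammaRD t r : R) :
  0 < t -> eta * gammaRD = t ^ 2 -> 0 <= r <= 1 ->
  gammaD eta Psi gammaSR gammaRD r =
  Psi * gammaSR * t ^ 2 / (1 + t) ^ 2
  * (1 - ((1 + t) * r - 1) ^ 2 / (t ^ 2 * r + (1 - r))).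
Proof.
  intros Ht Hg Hr.
  assert (Hden := gammaD_denominator_pos (t ^ 2) r (pow_lt t 2 Ht) Hr).
  unfold gammaD.
  (* Regrouping exposes the product [eta * gammaRD], the only form in which these two gains enter,
     so that [Hg] can replace it by [t ^ 2]. *)
  replace (eta * r * (1 - r) * Psi * gammaSR * gammaRD)
    with (eta * gammaRD * r * (1 - r) * Psi * gammaSR) by ring.
  replace (eta * r * gammaRD) with (eta * gammaRD * r) by ring.
  rewrite Hg; field; lra.
Qed.

(** An equivalence because the forward direction serves uniqueness of the maximizer and the backward
    one its optimality. *)
Lemma Rlog2_1p_le (x y : R) :
  0 <= x -> 0 <= y ->
  1 / 2 * Rlog 2 (1 + x) <= 1 / 2 * Rlog 2 (1 + y) <-> x <= y.
Proof.
  intros Hx Hy; unfold Rlog.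
  assert (Hl : 0 < / ln 2) by (apply Rinv_0_lt_compat; rewrite <- ln_1; apply ln_increasing; lra).
  split; intro H.
  - destruct (Rle_or_lt x y) as [|Hlt]; [assumption|exfalso].
    assert (Hln : ln (1 + y) < ln (1 + x)) by (apply ln_increasing; lra).
    apply (Rmult_lt_compat_r _ _ _ Hl) in Hln.
    unfold Rdiv in H; lra.
  - assert (Hln : ln (1 + x) <= ln (1 + y)) by (apply ln_le; lra).
    apply (Rmult_le_compat_r (/ ln 2)) in Hln; [|lra].
    unfold Rdiv; lra.
Qed.

Theorem mainTheorem3 (eta Psi gammaSR gammaRD : R) (hRD : C)
    (Heta : 0 < eta <= 1) (HPsi : 0 < Psi) (HgammaSR : 0 < gammaSR)
    (HhRD : hRD <> 0%C) (HgammaRD : gammaRD = Cmod hRD ^ 2) :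
  forall rho : R,
    is_maximizer (fun r : R => 0 <= r <= 1) (C_AF eta Psi gammaSR gammaRD) rho
    <-> rho = 1 / (1 + Cmod hRD * sqrt eta).
Proof.
  assert (Hh : 0 < Cmod hRD) by (apply Cmod_gt_0; exact HhRD).
  assert (Hs : 0 < sqrt eta) by (apply sqrt_lt_R0; lra).
  set (t := Cmod hRD * sqrt eta).
  assert (Ht : 0 < t) by (apply Rmult_lt_0_compat; assumption).
  assert (Hg : eta * gammaRD = t ^ 2).
  { unfold t; rewrite HgammaRD, Rpow_mult_distr, pow2_sqrt; [ring|lra]. }
  assert (HRD : 0 < gammaRD) by (rewrite HgammaRD; apply pow_lt, Hh).
  set (M := Psi * gammaSR * t ^ 2 / (1 + t) ^ 2).
  assert (HM : 0 < M).
  { unfold M; apply Rdiv_lt_0_compat; [|apply pow_lt; lra].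
    repeat apply Rmult_lt_0_compat; lra. }
  set (r0 := 1 / (1 + t)).
  assert (Hr0 : 0 <= r0 <= 1).
  { assert (0 < r0) by (apply Rdiv_lt_0_compat; lra).
    (* Hence [r0 = 1 - t * r0], which is at most 1 because [t] and [r0] are positive. *)
    assert ((1 + t) * r0 = 1) by (unfold r0; field; lra).
    split; nra. }
  assert (Hrate : forall r s, 0 <= r <= 1 -> 0 <= s <= 1 ->
    C_AF eta Psi gammaSR gammaRD r <= C_AF eta Psi gammaSR gammaRD s <->
    gammaD eta Psi gammaSR gammaRD r <= gammaD eta Psi gammaSR gammaRD s).
  { intros r s Hr Hs'; apply Rlog2_1p_le; apply gammaD_nonneg; lra. }
  assert (Hmax : gammaD eta Psi gammaSR gammaRD r0 = M).
  { rewrite (gammaD_complete_square _ _ _ _ t) by assumption; fold M.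
    replace ((1 + t) * r0 - 1) with 0 by (unfold r0; field; lra).
    unfold Rdiv; ring. }
  intro rho; split.
  - intros [Hrho Hopt].
    (* For uniqueness, the single competitor [r0] suffices. *)
    specialize (Hopt r0 Hr0); apply Hrate in Hopt; [|assumption..].
    rewrite Hmax, (gammaD_complete_square _ _ _ _ t) in Hopt by assumption.
    fold M in Hopt.
    assert (Hden := gammaD_denominator_pos (t ^ 2) rho (pow_lt t 2 Ht) Hrho).
    set (d := t ^ 2 * rho + (1 - rho)) in *.
    set (u := (1 + t) * rho - 1) in *.
    (* [Hopt] now reads [M <= M * (1 - u ^ 2 / d)], and [M] is positive. *)
    assert (Hu : u ^ 2 / d <= 0) by nra.
    (* Multiplying back by [d > 0] gives [u ^ 2 <= 0], which forces [u = 0]. *)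
    assert (Hu2 : u ^ 2 = u ^ 2 / d * d) by (field; lra).
    assert (Hu0 : u = 0) by nra.
    unfold u in Hu0; unfold r0.
    apply (Rmult_eq_reg_l (1 + t)); [|lra].
    transitivity 1; [lra|field; lra].
  - intros ->; split; [assumption|].
    intros y Hy; apply Hrate; [assumption..|].
    rewrite Hmax, (gammaD_complete_square _ _ _ _ t) by assumption; fold M.
    assert (Hden := gammaD_denominator_pos (t ^ 2) y (pow_lt t 2 Ht) Hy).
    (* This fraction, scaled by [M > 0], is the amount by which the SNR at [y] falls short of
       [M]. *)
    assert (0 <= ((1 + t) * y - 1) ^ 2 / (t ^ 2 * y + (1 - y)))
      by (apply Rdiv_le_0_compat; [apply pow2_ge_0|exact Hden]).
    nra.
Qed.
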